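(* Let $N\ge 2$ and let $$\mathcal Q_N=\{\pi_{a,b}(X)=aX^2+bX\in\mathbb Z_N[X]:\ \pi_{a,b}\text{ permutes }\mathbb Z_N,\ a\not\equiv 0\pmod N\}.$$ Then the following are equivalent: (1) $\mathcal Q_N\neq\varnothing$ and, for every $\pi\in\mathcal Q_N$, every $u\in\mathbb Z$ with $\gcd(u,N)=1$ and every $q\in\mathbb Z$, the sequence $k\mapsto z_{u,q,N}(\pi(k))$ on $\mathbb Z_N$ is inequivalent to every Zadoff--Chu sequence; (2) $N$ is odd, $9\nmid N$, and there exists a prime $p\ge5$ with $p^2\mid N$. In particular, $N=75=3\cdot 5^2$ satisfies (2) but is not a prime power; hence $N=75$ is a counterexample to the assertion that (1) holds only if $N=p^n$ with $p>3$ prime and $n>1$.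
   Context: Write $\mathbb Z_N=\mathbb Z/N\mathbb Z$, $\zeta_N=\exp(-\pi\sqrt{-1}/N)$, $W_N=\zeta_N^2=\exp(-2\pi\sqrt{-1}/N)$, and $\varepsilon_N=N\bmod 2\in\{0,1\}$. For $u\in\mathbb Z$ with $\gcd(u,N)=1$ and $q\in\mathbb Z$, the length-$N$ Zadoff--Chu sequence is $z_{u,q,N}(t)=\zeta_N^{u(t+\varepsilon_N+2q)t}$; this depends only on $t$ modulo $N$, so it is a function on $\mathbb Z_N$. Equivalence is under the five operations on sequences $s:\mathbb Z_N\to\mathbb C$: $s(k)\mapsto c\,s(k)$ with $|c|=1$; $s(k)\mapsto s(k+d)$ with $d\in\mathbb Z_N$; $s(k)\mapsto s(rk)$ with $r\in\mathbb Z_N^\times$; $s(k)\mapsto W_N^{\lambda k}s(k)$ with $\lambda\in\mathbb Z_N$; $s(k)\mapsto\overline{s(k)}$. Equivalently, a sequence $s$ on $\mathbb Z_N$ is equivalent to a Zadoff--Chu sequence if there exist $\sigma\in\{\pm1\}$, $r\in\mathbb Z_N^\times$, $d,\lambda\in\mathbb Z_N$, $u'$ coprime to $N$, $q'$, and a unimodular constant $c$ such that $s(k)=c\,W_N^{\lambda k}\,\zeta_N^{\sigma u'(rk+d+\varepsilon_N+2q')(rk+d)}$ for all $k\in\mathbb Z_N$. *)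

(* Defs.v *)
From HB Require Import structures.
From mathcomp Require Import all_boot all_order all_algebra.
From mathcomp Require Import complex.
From mathcomp Require Import classical_sets reals topology normedtype sequences.
From mathcomp Require Import exp trigo.
From mathcomp Require Import ring zify.
From Stdlib Require Import Relation_Operators.

Set Implicit Arguments.
Unset Strict Implicit.
Unset Printing Implicit Defensive.

Import Order.TTheory GRing.Theory Num.Theory.
Local Open Scope ring_scope.

(* Residues mod N (N >= 2) are 'Z_N, and a length-N sequence
   is a finite function on 'Z_N with values in the complex numbers R[i]. *)

Definition permutes (N : nat) (p : {poly 'Z_N}) : Prop :=
  bijective (fun x : 'Z_N => p.[x]).

Definition QPP (N : nat) : set {poly 'Z_N} :=
  [set p | exists a b : 'Z_N,
     [/\ p = a *: 'X^2 + b *: 'X, permutes p & a != 0]]%classic.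
Arguments QPP : clear implicits.

Section ZadoffChu.

Variable R : realType.

(* exp(sqrt(-1) * x) *)
Definition expi (x : R) : R[i] := Complex (cos x) (sin x).

Definition zeta (N : nat) : R[i] := expi (- (pi / N%:R)).

Definition W (N : nat) : R[i] := zeta N ^+ 2.

Definition zc (u q : int) (N : nat) (t : int) : R[i] :=
  zeta N ^ (u * (t + (N %% 2)%N%:Z + 2 * q) * t).

Definition zseq (N : nat) : Type := {ffun 'Z_N -> R[i]}.

(* A residue is evaluated at its representative in {0, .., N - 1}; by
   [zc_mod] below every other representative gives the same value. *)
Definition zc_seq (u q : int) (N : nat) : zseq N :=
  [ffun k : 'Z_N => zc u q N (k : nat)%:Z].

Definition is_zc (N : nat) (s : zseq N) : Prop :=
  exists u q : int, coprimez u N%:Z /\ s = zc_seq u q N.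

(* In the modulation step the exponent is the representative of lam * k;
   this is harmless since W N has order N. *)
Inductive zc_step (N : nat) (s : zseq N) : zseq N -> Prop :=
| StepScale (c : R[i]) of `|c| = 1 : zc_step s [ffun k => c * s k]
| StepShift (d : 'Z_N) : zc_step s [ffun k => s (k + d)]
| StepDecimate (r : 'Z_N) of r \is a GRing.unit :
    zc_step s [ffun k => s (r * k)]
| StepModulate (lam : 'Z_N) :
    zc_step s [ffun k => W N ^+ nat_of_ord (lam * k) * s k]
| StepConj : zc_step s [ffun k => (s k)^*].

Definition zc_equiv (N : nat) : zseq N -> zseq N -> Prop :=
  clos_refl_sym_trans (zseq N) (@zc_step N).

Definition zc_permuted (u q : int) (N : nat) (p : {poly 'Z_N}) : zseq N :=
  [ffun k : 'Z_N => zc_seq u q N p.[k]].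

Definition all_inequivalent (N : nat) : Prop :=
  (QPP N !=set0)%classic /\
  forall (p : {poly 'Z_N}) (u q : int), QPP N p -> coprimez u N%:Z ->
    forall s : zseq N, is_zc s -> ~ zc_equiv (zc_permuted u q p) s.

Lemma expiD x y : expi (x + y) = expi x * expi y.
Proof.
rewrite /expi cosD sinD; apply/eqP.
by rewrite eq_complex /= eqxx /= addrC.
Qed.

Lemma expi0 : expi 0 = 1.
Proof. by rewrite /expi cos0 sin0. Qed.

Lemma expiX x n : expi x ^+ n = expi (x *+ n).
Proof.
elim: n => [|n IHn]; first by rewrite mulr0n expr0 expi0.
by rewrite exprS mulrS expiD IHn.
Qed.

Lemma zeta_neq0 N : zeta N != 0.
Proof.
apply/eqP => z0; have := expiD (- (pi / N%:R)) (pi / N%:R).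
by rewrite -/(zeta N) z0 mul0r addNr expi0 => /eqP; rewrite oner_eq0.
Qed.

Lemma zeta_order N : (0 < N)%N -> zeta N ^ (2 * N%:Z) = 1.
Proof.
move=> N0; rewrite -[2]/(2%N : int) -PoszM -exprnP expiX.
have -> : - (pi / N%:R) *+ (2 * N) = - (pi *+ 2) :> R.
  have N0' : N%:R != 0 :> R by rewrite pnatr_eq0 -lt0n.
  by rewrite mulNrn mulnC mulrnA -[_ *+ N]mulr_natr divfK.
by rewrite /expi cosN sinN cos2pi sin2pi oppr0.
Qed.

Lemma zc_mod (u q : int) (N : nat) (t m : int) : (0 < N)%N ->
  zc u q N (t + m * N%:Z) = zc u q N t.
Proof.
move=> N0; rewrite /zc; set e : int := (N %% 2)%N%:Z.
have [j Ej] : exists j : int, m * (m * N%:Z + e) = 2 * j.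
  have -> : N%:Z = e + 2 * (N %/ 2)%N%:Z.
    by rewrite {1}(divn_eq N 2) PoszD PoszM; ring.
  have [i Ei] : exists i : int, m * (m * e + e) = 2 * i.
    have := divz_eq m 2; set k := (m %/ 2)%Z; set r := (m %% 2)%Z => Em.
    have : r = 0 \/ r = 1.
      have : 0 <= r < 2 by rewrite modz_ge0// ltz_pmod.
      by lia.
    case=> Er; rewrite Em Er.
      by exists (k * (k * 2 + 1) * e); ring.
    by exists ((k * 2 + 1) * (k + 1) * e); ring.
  exists (i + m * m * (N %/ 2)%N%:Z); rewrite [RHS]mulrDr -Ei; ring.
have -> : u * (t + m * N%:Z + e + 2 * q) * (t + m * N%:Z) =
  u * (t + e + 2 * q) * t + 2 * N%:Z * (u * (m * t + j + m * q)).
  have -> : 2 * N%:Z * (u * (m * t + j + m * q)) =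
    N%:Z * u * (2 * m * t + 2 * j + 2 * m * q) by ring.
  by rewrite -Ej; ring.
by rewrite expfzDr ?zeta_neq0// -[X in _ * X]exprz_exp zeta_order// exp1rz mulr1.
Qed.

End ZadoffChu.

Definition arith_cond (N : nat) : Prop :=
  [/\ odd N, ~~ (9 %| N)%N
    & exists p : nat, [/\ prime p, (5 <= p)%N & (p ^ 2 %| N)%N]].

Definition prime_power (N : nat) : Prop :=
  exists p n : nat, [/\ prime p, (0 < n)%N & N = (p ^ n)%N].

Definition big_prime_power (N : nat) : Prop :=
  exists p n : nat, [/\ prime p, (3 < p)%N, (1 < n)%N & N = (p ^ n)%N].

(* Main.v *)
(** Sequences [s] with [s(k+h+d) s(d) = W^(v k h) s(k+d) s(h+d)] for some [v] are
    stable under the five operations, and Zadoff--Chu sequences are among them.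
    If [z_{u,q,N}] composed with [aX^2+bX] is one of them, the triples
    [(k,h,d) = (1,1,0), (1,-1,0), (2,1,0)] give [N | 12a^2] and [N | 6a(a+b)]. For
    [N] odd, a permutation [aX^2+bX] has [p | a] and [p] not dividing [b] for
    every prime [p | N], so [N | 3a]; if moreover [9] does not divide [N], then
    [N | a].

    Conversely, for [N = 2m] the polynomial [mX^2+(1-m)X] acts as the identity,
    and for [N] odd divisible by [9] the sequence [z_{1,(N-1)/2,N}] composed with
    [(N/3)X^2+X] is a modulation of [z_{1,(N-1)/2,N}]. *)

Require Import Defs.
From mathcomp Require Import all_boot all_order all_algebra.
From mathcomp Require Import complex reals trigo.
From mathcomp Require Import ring lra zify.
From Stdlib Require Import Relation_Operators.

Set Implicit Arguments.
Unset Strict Implicit.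
Unset Printing Implicit Defensive.

Import Order.TTheory GRing.Theory Num.Theory.
Local Open Scope ring_scope.

(** * Residues modulo N through integer representatives *)

Lemma Zp_intr_eq0 (N : nat) (t : int) : (1 < N)%N ->
  (t%:~R == 0 :> 'Z_N) = (N%:Z %| t)%Z.
Proof.
move=> N1; have nat_eq0 n : (n%:R == 0 :> 'Z_N) = (N %| n)%N.
  by rewrite -val_eqE /= val_Zp_nat.
case: t => n; first by rewrite dvdzE /= nat_eq0.
by rewrite NegzE mulrNz oppr_eq0 dvdzE abszN /= nat_eq0.
Qed.

Lemma Zp_intrK (N : nat) (x : 'Z_N) : (x : nat)%:Z%:~R = x.
Proof. exact: natr_Zp. Qed.

Lemma Zp_intr_val (N : nat) (t : int) : (1 < N)%N ->
  exists m : int, ((t%:~R : 'Z_N) : nat)%:Z = t + m * N%:Z.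
Proof.
move=> N1; set x : 'Z_N := t%:~R.
have : ((x : nat)%:Z - t)%:~R == 0 :> 'Z_N.
  by rewrite rmorphB /= Zp_intrK subrr.
by rewrite Zp_intr_eq0// => /dvdzP[m Em]; exists m; rewrite -Em; ring.
Qed.

Lemma dvdz2_sqr_sub (t : int) : (2 %| t ^+ 2 - t)%Z.
Proof.
rewrite -(@Zp_intr_eq0 2)// rmorphB rmorphXn /=.
by case: (t%:~R : 'Z_2) => [[|[|//]] ?].
Qed.

Lemma dvdz3_cube_sub (t : int) : (3 %| t ^+ 3 - t)%Z.
Proof.
rewrite -(@Zp_intr_eq0 3)// rmorphB rmorphXn /=.
by case: (t%:~R : 'Z_3) => [[|[|[|//]]] ?].
Qed.

(** * Powers of [W] and the invariant of the five operations *)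

Section Phases.

Variable R : realType.

Local Notation zeta := (zeta R).
Local Notation W := (W R).

Lemma W_exp (N : nat) (t : int) : W N ^ t = zeta N ^ (2 * t).
Proof. by rewrite /Defs.W exprnP exprz_exp. Qed.

Lemma W_order (N : nat) (m : int) : (1 < N)%N -> W N ^ (m * N%:Z) = 1.
Proof.
move=> N1; rewrite W_exp mulrCA mulrC -exprz_exp zeta_order ?exp1rz//.
exact: ltnW.
Qed.

Lemma W_neq0 (N : nat) : W N != 0.
Proof. by rewrite expf_neq0// zeta_neq0. Qed.

(** Let r be the remainder of t modulo N. If r > 0, then pi r/N lies strictly between 0 and pi,
    where sin is positive; but the real part cos(2 pi r/N) of W^r equals 1 only when sin(pi r/N) =
    0. *)
Lemma W_primitive (N : nat) (t : int) : (1 < N)%N -> W N ^ t = 1 ->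
  (N%:Z %| t)%Z.
Proof.
move=> N1 Wt; have N0 : N%:Z != 0 by lia.
apply/dvdz_mod0P.
have : W N ^ (t %% N)%Z = 1.
  rewrite -[LHS]mul1r -(W_order (t %/ N)%Z N1) -expfzDr ?W_neq0//.
  by rewrite -divz_eq Wt W_order.
have := modz_ge0 t N0; have := @ltz_pmod t N (ltnW N1).
case: (t %% N)%Z => // -[|r]// rN _.
rewrite -exprnP /Defs.W -exprM expiX mulnC mulrnA mulNrn.
move=> /(congr1 (@complex.Re R)); rewrite /= mulNrn cosN cos_mulr2n => c1.
set x := _ *+ r.+1 in c1.
have NR0 : 0 < N%:R :> R by rewrite ltr0n ltnW.
have /sin_gt0_pi : 0 < x < pi.
  rewrite /x -[_ *+ r.+1]mulr_natr mulrAC; apply/andP; split.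
    by rewrite divr_gt0 // mulr_gt0 ?pi_gt0 ?ltr0n.
  by rewrite ltr_pdivrMr// ltr_pM2l ?pi_gt0// ltr_nat; move: rN; lia.
suff -> : sin x = 0 by rewrite ltxx.
apply/eqP; rewrite -sqrf_eq0; apply/eqP; have := cos2Dsin2 x.
move: c1; rewrite mulr2n => c1 c2; lra.
Qed.

(** An additive character of Z_N: the representative is immaterial because W^N = 1. *)
Definition phase (N : nat) (x : 'Z_N) : R[i] := W N ^+ (x : nat).

Lemma phaseE (N : nat) (x : 'Z_N) : phase x = W N ^+ (x : nat).
Proof. by []. Qed.

Lemma phase_intr (N : nat) (t : int) : (1 < N)%N ->
  phase (t%:~R : 'Z_N) = W N ^ t.
Proof.
move=> N1; rewrite /phase exprnP; have [m ->] := Zp_intr_val t N1.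
by rewrite expfzDr ?W_neq0// W_order// mulr1.
Qed.

Lemma phaseD (N : nat) (x y : 'Z_N) : (1 < N)%N ->
  phase (x + y) = phase x * phase y.
Proof.
move=> N1; rewrite -(Zp_intrK x) -(Zp_intrK y) -rmorphD /= !phase_intr//.
by rewrite expfzDr ?W_neq0.
Qed.

Lemma zc_seq_intr (u q : int) (N : nat) (t : int) : (1 < N)%N ->
  zc_seq R u q N t%:~R = zc R u q N t.
Proof.
move=> N1; rewrite ffunE; have [m ->] := Zp_intr_val t N1.
exact/zc_mod/ltnW.
Qed.

Lemma conj_expi (x : R) : (expi x)^* = expi (- x).
Proof. by rewrite /expi cosN sinN. Qed.

Lemma conj_phase (N : nat) (x : 'Z_N) : (1 < N)%N -> (phase x)^* = phase (- x).
Proof.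
move=> N1; have xV : phase x * phase (- x) = 1.
  by rewrite -phaseD// subrr -(mulr0z 1) phase_intr.
have xJ : phase x * (phase x)^* = 1.
  by rewrite /phase /Defs.W -exprM expiX conj_expi -expiD subrr expi0.
have x0 : phase x != 0 by rewrite expf_neq0// W_neq0.
by apply: (mulfI x0); rewrite xV xJ.
Qed.

(* Satisfied by [W ^ Q] for [Q] a quadratic with second difference [v]; unlike
   membership in the class of Zadoff--Chu sequences it is visibly stable under
   the five operations. *)
Definition quadratic_phase (N : nat) (s : zseq R N) : Prop :=
  exists v : 'Z_N, forall d k h : 'Z_N,
    s (k + h + d) * s d = phase (v * k * h) * (s (k + d) * s (h + d)).

(** Each operation is undone by one of the same kind, so the invariant needs checking in one
    direction only. *)
Lemma zc_step_sym (N : nat) (s s' : zseq R N) : (1 < N)%N ->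
  zc_step s s' -> zc_step s' s.
Proof.
move=> N1 [c c1|d|r ru|lam|].
- have sE : s = [ffun k => c^-1 * [ffun k => c * s k] k].
    by apply/ffunP=> k; rewrite !ffunE mulKf// -normr_eq0 c1 oner_eq0.
  by rewrite [X in zc_step _ X]sE; apply: StepScale; rewrite normfV c1 invr1.
- have sE : s = [ffun k => [ffun k => s (k + d)] (k - d)].
    by apply/ffunP=> k; rewrite !ffunE subrK.
  by rewrite [X in zc_step _ X]sE; apply: StepShift.
- have sE : s = [ffun k => [ffun k => s (r * k)] (r^-1 * k)].
    by apply/ffunP=> k; rewrite !ffunE mulVKr.
  by rewrite [X in zc_step _ X]sE; apply: StepDecimate; rewrite unitrV.
- set m := finfun _.
  have sE : s = [ffun k => W N ^+ ((- lam * k)%R : 'Z_N) * m k].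
    apply/ffunP=> k; rewrite !ffunE mulrA.
    rewrite -!phaseE -phaseD// mulNr addNr.
    by rewrite -(mulr0z 1) phase_intr// mul1r.
  by rewrite [X in zc_step _ X]sE; apply: StepModulate.
- have sE : s = [ffun k => ([ffun k => (s k)^*] k)^*].
    by apply/ffunP=> k; rewrite !ffunE conjCK.
  by rewrite [X in zc_step _ X]sE; apply: StepConj.
Qed.

(** Both sides of the defining identity are products of two values of s whose arguments add up to
    k+h+2d, so constants and linear phases cancel. Decimation by r replaces v by v r^2, conjugation
    replaces it by -v. *)
Lemma zc_step_quadratic_phase (N : nat) (s s' : zseq R N) : (1 < N)%N ->
  zc_step s s' -> quadratic_phase s -> quadratic_phase s'.
Proof.
move=> N1 [c c1|d0|r ru|lam|] [v sP].
- by exists v => d k h; rewrite !ffunE mulrACA sP; ring.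
- exists v => d k h; rewrite !ffunE.
  by have := sP (d + d0) k h; rewrite !addrA.
- exists (v * r ^+ 2) => d k h; rewrite !ffunE !mulrDr sP.
  by congr (phase _ * _); ring.
- exists v => d k h; rewrite !ffunE mulrACA sP -!phaseE -phaseD//.
  rewrite [X in _ = _ * X]mulrACA -phaseD// [LHS]mulrCA.
  by congr (_ * (phase _ * _)); ring.
- exists (- v) => d k h; rewrite !ffunE -!rmorphM /= sP rmorphM /= conj_phase//.
  by rewrite !mulNr.
Qed.

Lemma zc_equiv_quadratic_phase (N : nat) (s s' : zseq R N) : (1 < N)%N ->
  zc_equiv s s' -> quadratic_phase s <-> quadratic_phase s'.
Proof.
move=> N1; elim=> {s s'} [s s' ss'|//|s s' _ <-//|s1 s2 s3 _ -> _ ->//].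
by split; apply: zc_step_quadratic_phase => //; apply: zc_step_sym.
Qed.

Lemma zc_quadratic_phase (u q : int) (N : nat) : (1 < N)%N ->
  quadratic_phase (zc_seq R u q N).
Proof.
move=> N1; exists u%:~R => d k h.
rewrite -(Zp_intrK d) -(Zp_intrK k) -(Zp_intrK h) -!(rmorphM, rmorphD) /=.
rewrite !zc_seq_intr// phase_intr// W_exp /zc -!expfzDr ?zeta_neq0//.
by congr (_ ^ _); ring.
Qed.

Lemma quadratic_phase_permuted (a b u q : int) (N : nat) :
  (1 < N)%N -> coprimez u N%:Z ->
  quadratic_phase
    (zc_permuted R u q (a%:~R *: 'X^2 + b%:~R *: 'X : {poly 'Z_N})) ->
  (N%:Z %| 12 * a ^+ 2)%Z /\ (N%:Z %| 6 * a * (a + b))%Z.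
Proof.
move=> N1 uN [w]; set s := zc_permuted _ _ _ _ => sP.
have sE (t : int) : s t%:~R = zc R u q N (a * t ^+ 2 + b * t).
  rewrite ffunE -zc_seq_intr//; congr (zc_seq R u q N _).
  by rewrite !hornerE rmorphD !rmorphM /=; ring.
pose v : int := (w : nat)%:Z.
(* The identity at d = 0, where s(0) = 1: since W = zeta^2, this is half the difference of the
   exponents of zeta. *)
have vP (k h : int) : (N%:Z %| k * h * (u * (2 * a ^+ 2 * (k ^+ 2 + h ^+ 2)
    + 3 * a ^+ 2 * k * h + 3 * a * b * (k + h) + b ^+ 2
    + a * ((N %% 2)%N%:Z + 2 * q)) - v))%Z.
  have := sP 0%:~R k%:~R h%:~R; rewrite -(Zp_intrK w) -/v.
  rewrite -!(rmorphM, rmorphD) /= !sE phase_intr// W_exp /zc.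
  rewrite -!expfzDr ?zeta_neq0//.
  set e1 := (X in _ ^ X = _); set e2 := (X in _ = _ ^ X) => E.
  apply: W_primitive => //; rewrite W_exp.
  apply: (mulfI (expfz_neq0 e2 (zeta_neq0 R N))).
  by rewrite mulr1 -[RHS]E -expfzDr ?zeta_neq0//; congr (_ ^ _);
    rewrite /e1 /e2; ring.
have E1 := vP 1 1; have E2 := vP 1 (-1); have E3 := vP 2 1.
set c := b ^+ 2 + a * ((N %% 2)%N%:Z + 2 * q) in E1 E2 E3.
have uN' : coprimez N%:Z u by rewrite coprimez_sym.
split; rewrite -(Gauss_dvdzr _ uN').
  set e1 := (X in (_ %| X)%Z) in E1; set e2 := (X in (_ %| X)%Z) in E2.
  set e3 := (X in (_ %| X)%Z) in E3.
  (* This combination eliminates v, c and the ab term, leaving 12ua^2; below, [e1 + e2] leaves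
     6ua(a+b). *)
  rewrite (_ : u * _ = e3 - e1 * 3 - e2); last by rewrite /e1 /e2 /e3; ring.
  by rewrite !rpredB// dvdz_mulr.
set e1 := (X in (_ %| X)%Z) in E1; set e2 := (X in (_ %| X)%Z) in E2.
by rewrite (_ : u * _ = e1 + e2) ?rpredD// /e1 /e2; ring.
Qed.

End Phases.

(** * Quadratic permutation polynomials and divisibility of their coefficients *)

Lemma Fp_intr_eq0 (p : nat) (t : int) : prime p ->
  (t%:~R == 0 :> 'F_p) = (p%:Z %| t)%Z.
Proof.
by move=> pp; rewrite -[p in RHS](pdiv_id pp) -Zp_intr_eq0// pdiv_id ?prime_gt1.
Qed.

(** Surjectivity modulo N passes to F_p, where it gives injectivity by finiteness. If a is nonzero
    in F_p, then -b/a and 0 have the same image, so b = 0, and then 1 and -1 collide as p is odd. If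
    a = b = 0 the map is constant. *)
Lemma permutes_mod_prime (a b : int) (N p : nat) : (1 < N)%N ->
  prime p -> odd p -> (p %| N)%N ->
  permutes (a%:~R *: 'X^2 + b%:~R *: 'X : {poly 'Z_N}) ->
  (p%:Z %| a)%Z /\ ~~ (p%:Z %| b)%Z.
Proof.
move=> N1 pp po pN [g _ gK]; rewrite -!Fp_intr_eq0//.
pose f (x : 'F_p) : 'F_p := a%:~R * x ^+ 2 + b%:~R * x.
(* Lift to Z_N, invert there, reduce modulo p: a right inverse of [f]. *)
pose s (y : 'F_p) : 'F_p := (g (y : nat)%:R : nat)%:R.
have sK : cancel s f.
  move=> y; apply/eqP; rewrite /f /s -subr_eq0 -[y in _ - y]natr_Zp.
  have := gK (y : nat)%:R; set x : 'Z_N := g _; rewrite -(natr_Zp x) => /eqP.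
  rewrite !hornerE -subr_eq0.
  rewrite (_ : _ - _ =
    (a * (x : nat)%:Z ^+ 2 + b * (x : nat)%:Z - (y : nat)%:Z)%:~R);
    last by rewrite rmorphB rmorphD !rmorphM /=; ring.
  rewrite Zp_intr_eq0// => Nd.
  rewrite (_ : _ - _ =
    (a * (x : nat)%:Z ^+ 2 + b * (x : nat)%:Z - (y : nat)%:Z)%:~R);
    last by rewrite rmorphB rmorphD !rmorphM /= natr_Zp; ring.
  by rewrite Fp_intr_eq0//; apply: dvdz_trans Nd.
have f_inj : injective f.
  by apply/can_inj/(canF_sym sK).
have two_neq0 : 2 != 0 :> 'F_p.
  rewrite -[2]/((2 : int)%:~R) Fp_intr_eq0// dvdzE /=.
  by rewrite dvdn_prime2//; apply: contraTN po => /eqP ->.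
have a0 : a%:~R = 0 :> 'F_p.
  apply/eqP/negP => /negP a0.
  have b0 : b%:~R = 0 :> 'F_p.
    apply/eqP; have /f_inj/eqP : f (- b%:~R / a%:~R) = f 0 by rewrite /f; field.
    by rewrite mulf_eq0 invr_eq0 (negPf a0) orbF oppr_eq0.
  have /f_inj/eqP : f 1 = f (-1) by rewrite /f b0; ring.
  by rewrite -addr_eq0 (negPf two_neq0).
split; first by rewrite a0.
apply/eqP => b0; have /f_inj/eqP : f 1 = f 0 by rewrite /f a0 b0; ring.
by rewrite oner_eq0.
Qed.

(** With a = N/p one has a^2 = 0 in Z_N. The images of x and y differ by (x-y)(1+a(x+y)), and the
    second factor is a unit with inverse 1-a(x+y). *)
Lemma QPP_square_dvd (N p : nat) : (1 < N)%N -> (1 < p)%N -> (p ^ 2 %| N)%N ->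
  QPP N ((N %/ p)%N%:Z%:~R *: 'X^2 + 1%:Z%:~R *: 'X).
Proof.
move=> N1 p1 /dvdnP[m Em].
have -> : (N %/ p = m * p)%N by rewrite Em expnS expn1 mulnA mulnK// ltnW.
set a : 'Z_N := (m * p)%N%:Z%:~R; exists a, 1%:~R; split => //.
  have a2 : a ^+ 2 = 0.
    apply/eqP; rewrite -rmorphXn /= Zp_intr_eq0// Em; apply/dvdzP.
    by exists m%:Z; rewrite !PoszM -?exprnP; ring.
  apply: injF_bij => x y; rewrite !hornerE => E.
  apply/eqP; rewrite -subr_eq0; apply/eqP.
  transitivity ((x - y) * (1 + a * (x + y)) * (1 - a * (x + y))
                + a ^+ 2 * ((x - y) * (x + y) ^+ 2)); first by ring.
  rewrite a2 mul0r addr0.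
  rewrite [X in X * _](_ : _ = (a * x * x + x) - (a * y * y + y)); last by ring.
  by move: E; rewrite ?mul1r => ->; rewrite subrr mul0r.
rewrite Zp_intr_eq0// dvdzE /= Em.
have m0 : (0 < m)%N by move: N1; rewrite Em; case: (m).
by apply/negP => /dvdn_leq; nia.
Qed.

Lemma tripled_coef_dvd (a b : int) (N : nat) : (1 < N)%N -> odd N ->
  permutes (a%:~R *: 'X^2 + b%:~R *: 'X : {poly 'Z_N}) ->
  (N%:Z %| 12 * a ^+ 2)%Z -> (N%:Z %| 6 * a * (a + b))%Z ->
  (N%:Z %| 3 * a)%Z.
Proof.
move=> N1 No perm Na2 Nab.
have N2 : coprimez N%:Z 2 by rewrite coprimezE /= coprimen2.
have Nb : coprimez N%:Z b.
  rewrite coprimezE /=; apply/negP => /negP; rewrite /coprime => g1.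
  pose p := pdiv (gcdn N `|b|).
  have pg : (p %| gcdn N `|b|)%N := pdiv_dvd _.
  have pp : prime p.
    by rewrite pdiv_prime// ltn_neqAle eq_sym g1 gcdn_gt0 ltnW.
  have pN := dvdn_trans pg (dvdn_gcdl _ _).
  have [_] := permutes_mod_prime N1 pp (dvdn_odd pN No) pN perm.
  by rewrite dvdzE /= (dvdn_trans pg (dvdn_gcdr _ _)).
rewrite -(Gauss_dvdzr _ Nb) -(Gauss_dvdzr _ N2) -(Gauss_dvdzr _ N2).
(* Both sides equal 12ab, and the factor 4b is coprime to N. *)
rewrite (_ : 2 * _ = 6 * a * (a + b) * 2 - 12 * a ^+ 2); last by ring.
by rewrite rpredB// dvdz_mulr.
Qed.

Lemma coprime1z (n : int) : coprimez 1 n.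
Proof. by rewrite coprimezE coprime1n. Qed.

(** * The equivalence and the case N = 75 *)

Section Equivalence.

Variable R : realType.

Lemma arith_cond_inequivalent (N : nat) : (1 < N)%N -> arith_cond N ->
  all_inequivalent R N.
Proof.
move=> N1 [No N9 [p [pp p5 p2N]]]; split.
  by eexists; apply: (QPP_square_dvd N1 _ p2N); apply: prime_gt1.
move=> P u q [a' [b' [-> perm a0]]] uN s [u' [q' [_ ->]]].
move=> /(zc_equiv_quadratic_phase N1)[_ /(_ (zc_quadratic_phase _ _ _ N1))].
move: perm a0; rewrite -(Zp_intrK a') -(Zp_intrK b').
move: (a' : nat)%:Z (b' : nat)%:Z => a b perm +.
move=> a0 /(quadratic_phase_permuted N1 uN)[Na2 Nab]; move: a0.
have N3a := tripled_coef_dvd N1 No perm Na2 Nab.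
rewrite Zp_intr_eq0// => /negP; apply.
have [N3|N3] := boolP (3 %| N)%N; last first.
  by rewrite -(Gauss_dvdzr (n := 3)) // coprimezE /= coprime_sym prime_coprime.
have [a3 _] := permutes_mod_prime N1 (isT : prime 3) isT N3 perm.
(* Write N = 3M with M prime to 3, since 9 does not divide N. Then M divides a because N divides 3a,
   and 3 divides a by the permutation property. *)
have /dvdnP[M EM] := N3.
have M3 : coprime M 3.
  rewrite coprime_sym prime_coprime//; apply: contra N9 => M3.
  by rewrite EM -[9%N]/(3 * 3)%N dvdn_pmul2r.
rewrite dvdzE /= EM Gauss_dvd//; apply/andP; split; last exact: a3.
rewrite -(Gauss_dvdr (n := 3)) //.
apply: dvdn_trans (_ : N %| _)%N; first by rewrite EM dvdn_mulr.
by move: N3a; rewrite dvdzE abszM.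
Qed.

Lemma even_not_inequivalent (N : nat) : (1 < N)%N -> ~~ odd N ->
  ~ all_inequivalent R N.
Proof.
move=> N1 Ne [_ /(_ _ 1 0 _ (coprime1z N))].
pose a : 'Z_N := N./2%:Z%:~R.
pose P : {poly 'Z_N} := a *: 'X^2 + (1 - a) *: 'X.
have PK x : P.[x] = x.
  (* x^2 - x is even, so N/2 times it vanishes modulo N. *)
  have : a * (x ^+ 2 - x) = 0.
    rewrite -(Zp_intrK x) -rmorphXn -rmorphB -rmorphM /=; apply/eqP.
    rewrite Zp_intr_eq0//; have /dvdzP[w ->] := dvdz2_sqr_sub (x : nat)%:Z.
    have EN : N%:Z = 2 * N./2%:Z by lia.
    by apply/dvdzP; exists w; rewrite EN; ring.
  rewrite !hornerE /= => ax; transitivity (a * (x ^+ 2 - x) + x); first by ring.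
  by rewrite ax add0r.
move=> /(_ P) /=; apply.
- exists a, (1 - a); split => //; first by exists id => x /=; rewrite PK.
  by rewrite Zp_intr_eq0// dvdzE /=; apply/negP => /dvdn_leq; lia.
- by exists 1, 0; split; [exact: coprime1z | reflexivity].
rewrite (_ : zc_permuted _ _ _ _ = zc_seq R 1 0 N); first exact: rst_refl.
by apply/ffunP => k; rewrite ffunE PK.
Qed.

Lemma nine_dvd_not_inequivalent (N : nat) : (1 < N)%N -> odd N -> (9 %| N)%N ->
  ~ all_inequivalent R N.
Proof.
move=> N1 No N9 [_ all_ineq].
have := all_ineq _ 1 (N./2%:Z)
  (QPP_square_dvd N1 (isT : (1 < 3)%N) N9) (coprime1z N).
move=> /(_ (zc_seq R 1 N./2%:Z N)); apply.
  by exists 1, N./2%:Z; split; first exact: coprime1z.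
apply: rst_sym; apply: rst_step.
set P := (_ + _ : {poly _}).
rewrite (_ : zc_permuted _ _ _ _ =
  [ffun k => W R N ^+ ((N %/ 3)%N%:Z%:~R * k : 'Z_N)%R
     * zc_seq R 1 N./2%:Z N k]).
  exact: StepModulate.
apply/ffunP => x; rewrite ffunE [RHS]ffunE -(Zp_intrK x).
set t : int := (x : nat)%:Z; set a : int := (N %/ 3)%N%:Z.
have -> : P.[t%:~R] = (a * t ^+ 2 + t)%:~R.
  by rewrite !hornerE rmorphD !rmorphM /=; ring.
rewrite -phaseE -intrM phase_intr// !zc_seq_intr// W_exp /zc.
rewrite -expfzDr ?zeta_neq0// (_ : N %% 2 = 1)%N; last by rewrite modn2 No.
have /dvdnP[m Em] := N9.
have Ea : a = 3 * m%:Z by rewrite /a Em; lia.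
have EN : N%:Z = 9 * m%:Z by rewrite Em; lia.
(* This is why q = (N-1)/2 was chosen: 1 + 2q = N, so the exponent of z(t) becomes t(t+N). *)
have -> : 2 * N./2%:Z = N%:Z - 1 by lia.
have /dvdzP[w2 E2] := dvdz2_sqr_sub (t ^+ 2).
have /dvdzP[w3 E3] := dvdz3_cube_sub t.
set e1 := (X in _ ^ X = _); set e2 := (X in _ = _ ^ X).
have -> : e1 = e2 + 2 * N%:Z * (w3 + m%:Z * w2 + 2 * m%:Z * t ^+ 2).
  (* Each summand is a multiple of 2N = 18m, as 3 divides t^3 - t and 2 divides t^4 - t^2. *)
  suff : e1 - e2 = 6 * m%:Z * (t ^+ 3 - t) +
      9 * m%:Z ^+ 2 * ((t ^+ 2) ^+ 2 - t ^+ 2) + 36 * m%:Z ^+ 2 * t ^+ 2.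
    rewrite E2 E3 EN => E; rewrite -[e1](subrK e2) E; ring.
  by rewrite /e1 /e2 EN Ea; ring.
by rewrite expfzDr ?zeta_neq0// -exprz_exp zeta_order ?exp1rz ?mulr1// ltnW.
Qed.

Lemma all_inequivalentP (N : nat) : (1 < N)%N ->
  all_inequivalent R N <-> arith_cond N.
Proof.
move=> N1; split; last exact: arith_cond_inequivalent.
move=> ineq.
have No : odd N by apply/negP => /negP /(even_not_inequivalent N1).
have N9 : ~~ (9 %| N)%N by apply/negP => /(nine_dvd_not_inequivalent N1 No).
split=> //; case: ineq => [[P [a' [b' [-> + +]]]] _].
rewrite -(Zp_intrK a') -(Zp_intrK b').
move: (a' : nat)%:Z (b' : nat)%:Z => a b perm.
rewrite Zp_intr_eq0// dvdzE /= => /negP Na.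
(* As N does not divide a, the full p-part of N fails to divide a for some prime p; but p itself
   divides a, so that p-part is at least p^2. *)
have [p] : exists2 p, p \in \pi(N) & ~~ (N`_p %| `|a|)%N.
  apply/hasP; rewrite has_predC; apply/negP => /allP Npa; apply: Na.
  by apply/dvdn_partP => [|p pN]; [exact: ltnW | exact: Npa].
rewrite mem_primes => /and3P[pp N0 pN] Npa; have po := dvdn_odd pN No.
have [pa _] := permutes_mod_prime N1 pp po pN perm.
have p2N : (p ^ 2 %| N)%N.
  rewrite pfactor_dvdn//; move: Npa; rewrite p_part; apply: contraR.
  by rewrite -ltnNge ltnS => /(dvdn_exp2l p)/dvdn_trans; apply.
exists p; split => //; move: pp po p2N; case: p {pN pa Npa} => [|[|[|[|[]]]]]//.
by rewrite (negPf N9).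
Qed.

End Equivalence.

Theorem corollary1 (R : realType) :
  (forall N : nat, (2 <= N)%N -> (all_inequivalent R N <-> arith_cond N)) /\
  [/\ 75 = (3 * 5 ^ 2)%N, arith_cond 75, ~ prime_power 75,
      all_inequivalent R 75
    & ~ (forall N : nat, (2 <= N)%N ->
           all_inequivalent R N -> big_prime_power N)].
Proof.
have cond75 : arith_cond 75 by split=> //; exists 5%N.
have npp75 : ~ prime_power 75.
  move=> [p [n [pp n0 E]]].
  (* Both 3 and 5 would have to equal p. *)
  have : (3 %| p ^ n)%N by rewrite -E.
  have : (5 %| p ^ n)%N by rewrite -E.
  rewrite !Euclid_dvdX// => /andP[+ _] /andP[].
  by rewrite !dvdn_prime2// => /eqP <-.
split; first exact: all_inequivalentP.
have ineq75 : all_inequivalent R 75 by apply/all_inequivalentP.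
split=> // /(_ 75%N isT ineq75) [p [n [pp _ n1 E]]].
by apply: npp75; exists p, n; split => //; apply: ltnW.
Qed.
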